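(* Let $\{A_n\}_{n\geqslant 1}$ be i.i.d. nonnegative random variables with Laplace–Stieltjes transform $\alpha(s)=\mathbb{E}[e^{-sA_1}]$, and let $\{B_n\}_{n\geqslant 1}$ be i.i.d. exponentially distributed with rate $\mu>0$, independent of $\{A_n\}$. Let $W_1=w_1\geqslant 0$ be deterministic and $W_{n+1}=\max\{0,\,B_{n+1}-A_n-W_n\}$ for $n\geqslant 1$. Then for every $n\geqslant 1$ and $x\geqslant 0$, $$\mathbb{P}[W_{n+1}\leqslant x]=1-e^{-\mu x}\left[\frac{2\alpha(\mu)}{2+\alpha(\mu)}+\left(-\frac{\alpha(\mu)}{2}\right)^{n-1}\left(\frac{2-\alpha(\mu)}{2+\alpha(\mu)}-\mathbb{P}[W_2=0]\right)\right],$$ where $\mathbb{P}[W_2=0]=1-e^{-\mu w_1}\alpha(\mu)$. *)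

(* Defs.v *)
From HB Require Import structures.
From mathcomp Require Import all_boot all_order all_algebra.
From mathcomp Require Import all_classical all_reals all_analysis.
Set Implicit Arguments. Unset Strict Implicit. Unset Printing Implicit Defensive.
Import Order.TTheory GRing.Theory Num.Theory Num.Def.
Local Open Scope classical_set_scope.
Local Open Scope ring_scope.

Definition mutually_independent d (T : measurableType d) (R : realType)
  (P : probability T R) (I : eqType) (X : I -> T -> R) : Prop :=
  forall (s : seq I) (Y : I -> set R), uniq s -> (forall i, measurable (Y i)) ->
    P (\bigcap_(i in [set` s]) (X i @^-1` Y i)) =
    (\prod_(i <- s) P (X i @^-1` Y i))%E.

Definition LST d (T : measurableType d) (R : realType) (P : probability T R)
  (X : T -> R) (s : R) : R :=
  fine (\int[P]_x (expR (- s * X x))%:E)%E.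

(* Main.v *)
(* The variable W_n depends only on A_1, ..., A_{n-1}, B_2, ..., B_n, so W_n, A_n
   and B_{n+1} are independent. By memorylessness, for x >= 0,
     P(W_{n+1} > x) = P(B_{n+1} > x + A_n + W_n) = alpha w_n e^{-mu x}
   where w_n = E e^{-mu W_n}. A nonnegative variable with tail p e^{-mu x} has
   transform 1 - p/2 at mu, hence w_{n+1} = 1 - alpha w_n / 2, an affine
   recursion started at w_1 = e^{-mu w1}. *)
Require Import Defs.
From HB Require Import structures.
From mathcomp Require Import all_boot all_order all_algebra.
From mathcomp Require Import all_classical all_reals all_analysis.
From mathcomp Require Import measurable_realfun ring lra.
Import Order.TTheory GRing.Theory Num.Theory Num.Def.
Local Open Scope classical_set_scope.
Local Open Scope ring_scope.

(** * Independence of one variable from functions of finitely many others *)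

Definition independent {d d1 d2} {T : measurableType d}
    {T1 : measurableType d1} {T2 : measurableType d2} {R : realType}
    (P : probability T R) (X : T -> T1) (Y : T -> T2) : Prop :=
  forall U V, measurable U -> measurable V ->
    P (X @^-1` U `&` Y @^-1` V) = (P (X @^-1` U) * P (Y @^-1` V))%E.

Section cylinders.
Context {d} {T : measurableType d} {R : realType} {I : choiceType}.
Variable X : I -> T -> R.

(** A pi-system generating the sigma-algebra of the [X i] with [i] in [s], on which mutual
    independence gives product formulas directly. *)
Definition cylinders (s : seq I) : set (set T) :=
  [set E | exists2 Y : I -> set R, (forall i, measurable (Y i)) &
     E = \bigcap_(i in [set` s]) (X i @^-1` Y i)].

Definition measurable_wrt (s : seq I) (Z : T -> R) : Prop :=
  @measurable_fun _ _ (g_sigma_algebraType (cylinders s)) R setT Z.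

Lemma measurable_wrt_mem s i : i \in s -> measurable_wrt s (X i).
Proof.
move=> si _ V mV; rewrite setTI; apply: sub_sigma_algebra.
exists (fun j => if j == i then V else setT).
  by move=> j; case: ifP.
rewrite eqEsubset; split=> [t Vt j js /=|t /(_ i si)/=].
  by case: eqP => [->|].
by rewrite eqxx.
Qed.

Lemma setI_closed_cylinders s : setI_closed (cylinders s).
Proof.
move=> _ _ [Y mY ->] [Z mZ ->].
exists (fun i => Y i `&` Z i); first by move=> i; exact: measurableI.
by rewrite -bigcapI.
Qed.

Lemma setT_cylinders s : cylinders s setT.
Proof. by exists (fun=> setT) => //; rewrite bigcapT. Qed.

Lemma cylinders_measurable s :
  (forall i, measurable_fun setT (X i)) -> cylinders s `<=` measurable.
Proof.
move=> mX _ [Y mY ->]; rewrite bigcap_seq; apply: bigsetI_measurable => i _.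
by rewrite -[X in measurable X]setTI; exact: mX.
Qed.

(** For fixed [V], the finite measures sending [E] to the probability of [E] and [X i] in [V]
    jointly, and to the product of the two probabilities, agree on cylinders over [s]; by uniqueness
    on a pi-system they agree on all events determined by [s]. *)
Lemma mutually_independent_measurable_wrt (P : probability T R) s i Z :
  (forall i, measurable_fun setT (X i)) -> mutually_independent P X ->
  uniq s -> i \notin s -> measurable_wrt s Z -> independent P Z (X i).
Proof.
move=> mX indX us nis mZ U V mU mV.
have mF : measurable (X i @^-1` V).
  by rewrite -[X in measurable X]setTI; exact: mX.
have p0 : 0 <= fine (P (X i @^-1` V)) by rewrite fine_ge0.
have pE : (fine (P (X i @^-1` V)))%:E = P (X i @^-1` V).
  by rewrite fineK// fin_num_measure.
have mscaleE E : mscale (NngNum p0) P E = (P (X i @^-1` V) * P E)%E.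
  exact: (congr1 (fun z => z * P E)%E pE).
suff : mrestr P mF (Z @^-1` U) = mscale (NngNum p0) P (Z @^-1` U).
  by rewrite muleC -mscaleE.
apply: (@g_sigma_algebra_measure_unique _ _ _ (cylinders s) _ (fun=> setT)).
- exact: cylinders_measurable.
- by move=> _; exact: setT_cylinders.
- by rewrite bigcup_const//; exists 0%N.
- exact: setI_closed_cylinders.
- move=> _ [Y mY ->]; apply/esym; apply: etrans (mscaleE _) _; apply/esym.
  rewrite /= /mrestr.
  (* Since [i] is not in [s], putting [V] at coordinate [i] turns the intersection into one cylinder
     over [i :: s]. *)
  pose Y' j := if j == i then V else Y j.
  have mY' j : measurable (Y' j) by rewrite /Y'; case: ifP.
  have Y's j : j \in s -> Y' j = Y j.
    by rewrite /Y'; case: eqP => // ->; rewrite (negbTE nis).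
  have -> : \bigcap_(j in [set` s]) (X j @^-1` Y j) `&` X i @^-1` V =
      \bigcap_(j in [set` i :: s]) (X j @^-1` Y' j).
    rewrite !bigcap_seq big_cons setIC /Y' eqxx; congr (_ `&` _).
    by apply: eq_big_seq => j js; rewrite -/(Y' j) Y's.
  rewrite (indX (i :: s) Y')//=; last by rewrite nis.
  rewrite (indX s Y)// big_cons /Y' eqxx; congr (_ * _)%E.
  by apply: eq_big_seq => j js; rewrite -/(Y' j) Y's.
- by move=> k; rewrite /= /mrestr setTI ltey_eq fin_num_measure.
- by rewrite -[X in <<s _ >> X]setTI; exact: mZ.
Qed.

End cylinders.

(** Independence makes the joint law the product of the two laws, so Tonelli applies. *)
Lemma independent_integral {d d1 d2} {T : measurableType d}
    {T1 : measurableType d1} {T2 : measurableType d2} {R : realType}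
    (P : probability T R) (X : {RV P >-> T1}) (Y : {RV P >-> T2})
    (f : T1 * T2 -> \bar R) :
  independent P X Y -> measurable_fun setT f -> (forall z, 0 <= f z)%E ->
  (\int[P]_t f (X t, Y t) = \int[P]_t \int[distribution P Y]_y f (X t, y))%E.
Proof.
move=> indXY mf f0.
have mXY : measurable_fun setT (fun t => (X t, Y t)).
  exact: measurable_fun_pair.
pose XY : {mfun T >-> (T1 * T2)%type} :=
  HB.pack (fun t => (X t, Y t)) (isMeasurableFun.Build _ _ _ _ _ mXY).
transitivity (\int[distribution P XY]_z f z)%E.
  by rewrite ge0_integral_distribution.
rewrite (@eq_measure_integral _ _ _ _
  (distribution P X \x distribution P Y)%E); last first.
  by move=> A mA _; apply/esym/product_measure_unique.
rewrite fubini_tonelli1// /fubini_F ge0_integral_distribution//.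
- exact: measurable_fun_fubini_tonelli_F.
- by move=> x; exact: integral_ge0.
Qed.

(** * Tails of the exponential law *)

Section exponential_tail.
Context {R : realType} (mu : R) (L : probability R R).
Hypothesis expL : forall V, measurable V -> L V = exponential_prob mu V.

Lemma exponential_tail (x : R) : 0 <= x ->
  L [set b | x < b] = (expR (- mu * x))%:E.
Proof.
move=> x0.
have Lneg : L `]-oo, 0[%classic = 0%E.
  rewrite expL// /exponential_prob integral0_eq// => y.
  by rewrite /= in_itv/= => /lt0_exponential_pdf ->.
have L0x : L `[0, x]%classic = (1 - (expR (- mu * x))%:E)%E.
  (* The closed form on [[0, x]] serves for [0 < x]; at 0 the interval is a null singleton. *)
  rewrite expL//; move: x0; rewrite le_eqVlt => /predU1P[<-|x0].
    by rewrite set_itv1 mulr0 expR0 subee// /exponential_prob integral_set1.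
  exact: exponential_prob_itv0c.
have -> : [set b | x < b] = ~` (`]-oo, 0[ `|` `[0, x]).
  rewrite eqEsubset; split => b /=; rewrite !in_itv/=.
    move=> xb; apply/not_orP; split; apply/negP; rewrite -?leNgt ?(le_trans x0 (ltW _))//.
    by rewrite negb_and orbC -ltNge xb.
  by move=> /not_orP[/negP + /negP]; rewrite -leNgt => -> /=; rewrite -ltNge.
rewrite probability_setC; last exact: measurableU.
rewrite measureU//; last first.
  rewrite -subset0 => b [] /=; rewrite !in_itv/= => b0 /andP[].
  by rewrite leNgt b0.
rewrite [X in (_ - (X + _))%E]Lneg [X in (_ - (_ + X))%E]L0x add0e.
by rewrite oppeB ?addeA ?subee ?add0e.
Qed.

Lemma exponential_tail_le (x : R) : 0 <= x ->
  L [set b | x <= b] = (expR (- mu * x))%:E.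
Proof.
move=> x0; have -> : [set b | x <= b] = [set x] `|` [set b | x < b].
  rewrite eqEsubset; split => b /=; first by rewrite le_eqVlt => /predU1P[->|]; [left|right].
  by move=> [->//|/ltW].
rewrite measureU//.
- rewrite [X in (X + _)%E]expL// /exponential_prob integral_set1 add0e.
  exact: exponential_tail.
- by rewrite -set_itvoy.
- by rewrite -subset0 => b [/= ->]; rewrite ltxx.
Qed.

Lemma exponential_tail_le_max (z : R) :
  L [set b | z <= maxr 0 b] = (expR (- mu * maxr 0 z))%:E.
Proof.
have [z0|z0] := leP z 0.
  rewrite mulr0 expR0 -(probability_setT L); congr (L _).
  by rewrite -subTset => b _ /=; rewrite le_max z0.
rewrite -exponential_tail_le 1?ltW//; congr (L _).
by rewrite eqEsubset; split => b /=; rewrite le_max leNgt z0.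
Qed.

End exponential_tail.

Lemma measurable_lt_set {d} {T : measurableType d} {R : realType} (f g : T -> R) :
  measurable_fun setT f -> measurable_fun setT g -> measurable [set t | f t < g t].
Proof.
move=> mf mg; rewrite -[X in measurable X]setTI.
exact: (@measurable_fun_ltr _ _ _ _ f g mf mg measurableT [set true]).
Qed.

(** * Transform of a law with exponential tail *)

Section integrals.
Context {R : realType} (mu : R) (L : probability R R).
Hypothesis expL : forall V, measurable V -> L V = exponential_prob mu V.
Local Notation lst nu := (\int[nu]_z (expR (- mu * maxr 0 z))%:E)%E.

Lemma measurable_expR_max : measurable_fun setT (fun z : R => expR (- mu * maxr 0 z)).
Proof.
apply: measurableT_comp => //; apply: measurable_funM => //.
exact: measurable_maxr.
Qed.

(* For independent [Z] of law [nu] and [E] of law [L], this is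
   [P(Z <= max(0, E)) + P(Z > max(0, E)) = 1], conditioning on [Z] in the first
   term and on [E] in the second. With [max(0, E)] in place of [E] the
   conditional probabilities are exact for all real values, not only for
   nonnegative ones. *)
Lemma laplace_of_exponential_tail (nu : probability R R) (p : R) : 0 <= p ->
  (forall x, 0 <= x -> nu [set z | x < z] = (p * expR (- mu * x))%:E) ->
  (lst nu + p%:E * lst L = 1)%E.
Proof.
move=> p0 tail_nu.
pose D : set (R * R) := [set zb : R * R | maxr 0 zb.2 < zb.1].
have D1 z b : \1_D (z, b) = (z \in [set z | maxr 0 b < z])%:R :> R.
  by rewrite indicE; congr (_%:R); apply/idP/idP; rewrite !inE.
have mD : measurable D.
  by apply: measurable_lt_set => //; apply: measurable_maxr.
have mDf : measurable_fun setT (fun z : R * R => (\1_D z : R)%:E).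
  by apply/measurable_EFinP; exact: measurable_indic.
have <- : (\int[nu]_z \int[L]_b (\1_D (z, b) : R)%:E = p%:E * lst L)%E.
  rewrite (@fubini_tonelli _ _ _ _ _ nu L (fun z => (\1_D z : R)%:E))//.
  rewrite -ge0_integralZl_EFin//.
  - apply: eq_integral => b _; rewrite -EFinM -tail_nu ?le_max ?lexx//.
    transitivity (\int[nu]_z (\1_[set z | maxr 0 b < z] z)%:E)%E.
      by apply: eq_integral => z _; rewrite D1 indicE.
    by rewrite integral_indic// ?setIT// -set_itvoy.
  - by apply/measurable_EFinP; exact: measurable_expR_max.
rewrite -ge0_integralD//.
- rewrite (eq_integral (cst 1%E)).
    by rewrite integral_cst// mul1e; exact: probability_setT.
  move=> z _ /=.
  have m1 : measurable [set b : R | maxr 0 b < z].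
    by apply: measurable_lt_set => //; apply: measurable_maxr.
  have -> : (\int[L]_b (\1_D (z, b))%:E = L [set b | maxr 0 b < z]%R)%E.
    by rewrite -[in RHS](setIT [set b | _]) -integral_indic//.
  rewrite -(exponential_tail_le_max _ _ expL).
  rewrite (_ : [set b | z <= _] = ~` [set b | maxr 0 b < z]).
    by rewrite probability_setC// subeK// fin_num_measure.
  by rewrite eqEsubset; split => b /=; [move/le_gtF->|move/negP; rewrite leNgt].
- by apply/measurable_EFinP; exact: measurable_expR_max.
- by move=> z _; apply: integral_ge0 => b _; rewrite lee_fin.
- by apply: (@measurable_fun_fubini_tonelli_F _ _ _ _ _ L _ mDf) => z; rewrite lee_fin.
Qed.

(** [L] has the required tail with [p = 1], so taking [nu] to be [L] says that twice the transform
    is 1. *)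
Lemma laplace_exponential : lst L = (2^-1)%:E.
Proof.
have tailL x : 0 <= x -> L [set b | x < b] = (1 * expR (- mu * x))%:E.
  by rewrite mul1r; exact: exponential_tail.
have := laplace_of_exponential_tail L 1 ler01 tailL; rewrite mul1e.
(* An infinite value is incompatible with the identity, so finiteness comes for free. *)
case: (lst L) => [r| |]//; rewrite -EFinD => -[rr1]; congr (_%:E).
lra.
Qed.

Lemma laplace_of_exponential_tailE (nu : probability R R) (p : R) : 0 <= p ->
  (forall x, 0 <= x -> nu [set z | x < z] = (p * expR (- mu * x))%:E) ->
  lst nu = (1 - p / 2)%:E.
Proof.
move=> p0 tail_nu; have := laplace_of_exponential_tail nu p p0 tail_nu.
rewrite laplace_exponential.
case: (lst nu) => [r| |]//; rewrite -EFinM -EFinD => -[rp1]; congr (_%:E).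
lra.
Qed.
End integrals.

(** * Independent sums and exceedance by an exponential variable *)

Section independent_laplace.
Context {d} {T : measurableType d} {R : realType} {P : probability T R}.
Variable mu : R.

Lemma laplace_add (X Y : {RV P >-> R}) : independent P X Y ->
  (\int[P]_t (expR (- mu * (X t + Y t)))%:E =
   \int[P]_t (expR (- mu * X t))%:E * \int[P]_t (expR (- mu * Y t))%:E)%E.
Proof.
move=> indXY.
have mexp : measurable_fun setT (fun z : R => (expR (- mu * z))%:E).
  by apply/measurable_EFinP; apply: measurableT_comp => //; exact: measurable_funM.
rewrite (independent_integral P X Y
  (fun z : R * R => (expR (- mu * (z.1 + z.2)))%:E))//.
- rewrite -ge0_integralZr//.
  + apply: eq_integral => t _.
    under eq_integral do rewrite /= mulrDr expRD EFinM.
    by rewrite ge0_integralZl_EFin// ge0_integral_distribution.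
  + by apply: (measurableT_comp mexp).
  + by apply: integral_ge0 => t _; rewrite lee_fin expR_ge0.
- apply/measurable_EFinP; apply: measurableT_comp => //.
  by apply: measurable_funM => //; exact: measurable_funD.
Qed.

(** Memorylessness: with [Y] frozen at [y >= 0], [B] exceeds [x + y] with probability
    [expR (- mu * x) * expR (- mu * y)]; then average over [Y]. *)
Lemma exponential_exceeds (Y B : {RV P >-> R}) (x : R) :
  independent P Y B -> (forall t, 0 <= Y t) -> 0 <= x ->
  (forall V, measurable V -> distribution P B V = exponential_prob mu V) ->
  (P [set t | (x < B t - Y t)%R] =
   (expR (- mu * x))%:E * \int[P]_t (expR (- mu * Y t))%:E)%E.
Proof.
move=> indYB Y0 x0 expB.
pose D : set (R * R) := [set yb : R * R | x + yb.1 < yb.2].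
have mD : measurable D.
  by apply: measurable_lt_set => //; exact: measurable_funD.
have mS : measurable [set t | x < B t - Y t].
  by apply: measurable_lt_set => //; exact: measurable_funB.
rewrite -[[set t | _]]setIT -integral_indic//.
transitivity (\int[P]_t (\1_D (Y t, B t) : R)%:E)%E.
  rewrite (_ : [set t | _] = (fun t => (Y t, B t)) @^-1` D)//.
  by apply/funext => t; apply/propext; rewrite /D/= ltrBrDr.
rewrite (independent_integral P Y B (fun z : R * R => (\1_D z : R)%:E))//; last first.
  by apply/measurable_EFinP; exact: measurable_indic.
rewrite -ge0_integralZl_EFin//.
- apply: eq_integral => t _; rewrite -EFinM -expRD -mulrDr.
  rewrite -(exponential_tail mu _ expB) ?addr_ge0//.
  rewrite -[in RHS](setIT [set b | _]) -integral_indic//.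
  by rewrite -set_itvoy.
- apply/measurable_EFinP; apply: measurableT_comp => //; exact: measurable_funM.
Qed.

End independent_laplace.

(** * Measurability and independence along the recursion *)

Section recursion.
Context {d} {T : measurableType d} {R : realType} {P : probability T R}.
Variables (A B : nat -> {RV P >-> R}) (w1 : R) (W : nat -> T -> R).
Hypothesis W1 : forall t, W 1%N t = w1.
Hypothesis WS : forall n t, (1 <= n)%N ->
  W n.+1 t = maxr 0 (B n.+1 t - A n t - W n t).

Local Notation X := (fun i : nat + nat => match i with
                          | inl n => (A n.+1 : T -> R)
                          | inr n => (B n.+1 : T -> R) end).

(** With the index shift in [X], the assumptions place A_1, ..., A_m and B_1, ..., B_{m+1} in [s];
    unfolding the recursion for [W m.+1] stays within these. *)
Lemma measurable_wrt_W (s : seq (nat + nat)%type) (m : nat) :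
  (forall k, (k < m)%N -> inl k \in s) -> (forall k, (k <= m)%N -> inr k \in s) ->
  measurable_wrt X s (W m.+1).
Proof.
elim: m => [|m IHm] sA sB.
  by rewrite (_ : W 1%N = cst w1); [exact: measurable_cst|exact/funext].
rewrite (_ : W m.+2 = fun t => maxr 0 (X (inr m.+1) t - X (inl m) t - W m.+1 t)).
  apply: measurable_maxr; first exact: measurable_cst.
  apply: measurable_funB; last first.
    by apply: IHm => k km; [apply: sA|apply: sB]; exact: leqW.
  apply: measurable_funB.
    by apply: (@measurable_wrt_mem _ _ _ _ X _ (inr m.+1)); exact: sB.
  by apply: (@measurable_wrt_mem _ _ _ _ X _ (inl m)); exact: sA.
by apply/funext => t; rewrite WS.
Qed.

Lemma W_ge0 m t : 0 <= w1 -> 0 <= W m.+1 t.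
Proof. by case: m => [|m] w10; rewrite ?W1// WS// le_max lexx. Qed.

Lemma measurable_W m : measurable_fun setT (W m.+1).
Proof.
elim: m => [|m IHm].
  by rewrite (_ : W 1%N = cst w1); [exact: measurable_cst|exact/funext].
rewrite (_ : W m.+2 = fun t => maxr 0 (B m.+2 t - A m.+1 t - W m.+1 t)).
  by apply: measurable_maxr => //; apply: measurable_funB => //; exact: measurable_funB.
by apply/funext => t; rewrite WS.
Qed.

(** Codes for A_1, ..., A_p and B_1, ..., B_q. *)
Let past (p q : nat) : seq (nat + nat)%type :=
  [seq inl k | k <- iota 0 p] ++ [seq inr k | k <- iota 0 q].

Let inl_past p q k : (inl k \in past p q) = (k < p)%N.
Proof.
rewrite mem_cat mem_map; last by move=> ? ? [].
by rewrite mem_iota/= orbC; case: mapP => // -[? _].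
Qed.

Let inr_past p q k : (inr k \in past p q) = (k < q)%N.
Proof.
rewrite mem_cat orbC mem_map; last by move=> ? ? [].
by rewrite mem_iota/= orbC; case: mapP => // -[? _].
Qed.

Let uniq_past p q : uniq (past p q).
Proof.
rewrite cat_uniq !map_inj_uniq ?iota_uniq//; try by move=> ? ? [].
by rewrite andbT; apply/hasPn => _ /mapP[k _ ->]; apply/negP => /mapP[].
Qed.

Hypothesis indAB : mutually_independent P X.

Let mX i : measurable_fun setT (X i).
Proof. by case: i. Qed.

Lemma independent_W_A m : independent P (W m.+1) (A m.+1).
Proof.
apply: (@mutually_independent_measurable_wrt _ _ _ _ X P (past m m.+1) (inl m)) => //.
  by rewrite inl_past ltnn.
by apply: measurable_wrt_W => k; rewrite ?inl_past ?inr_past.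
Qed.

(** The sum is determined by [past m.+1 m.+1], and [B m.+2], coded [inr m.+1], is the first B
    outside it. *)
Lemma independent_AW_B m : independent P (fun t => A m.+1 t + W m.+1 t) (B m.+2).
Proof.
apply: (@mutually_independent_measurable_wrt _ _ _ _ X P (past m.+1 m.+1) (inr m.+1)) => //.
  by rewrite inr_past ltnn.
apply: measurable_funD.
  by apply: (@measurable_wrt_mem _ _ _ _ X _ (inl m)); rewrite inl_past.
by apply: measurable_wrt_W => k; rewrite ?inl_past ?inr_past// => /leqW.
Qed.

End recursion.

(* Indices n >= 1 are used; A 0, B 0, W 0 are irrelevant dummies. *)
Theorem theorem3p1 (d : measure_display) (T : measurableType d) (R : realType)
  (P : probability T R) (A B : nat -> {RV P >-> R}) (mu w1 : R)
  (W : nat -> T -> R) :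
  0 < mu -> 0 <= w1 ->
  (* A_n nonnegative, identically distributed *)
  (forall n t, (1 <= n)%N -> 0 <= A n t) ->
  (forall n V, (1 <= n)%N -> measurable V ->
     distribution P (A n) V = distribution P (A 1%N) V) ->
  (* B_n exponential with rate mu *)
  (forall n V, (1 <= n)%N -> measurable V ->
     distribution P (B n) V = exponential_prob mu V) ->
  (* the A_n (n >= 1) and B_n (n >= 1) are all mutually independent *)
  mutually_independent P
    (fun i : nat + nat => match i with
                          | inl n => (A n.+1 : T -> R)
                          | inr n => (B n.+1 : T -> R) end) ->
  (* the recursion *)
  (forall t, W 1%N t = w1) ->
  (forall n t, (1 <= n)%N -> W n.+1 t = maxr 0 (B n.+1 t - A n t - W n t)) ->
  let alpha := LST P (A 1%N) mu in
  P [set t | W 2%N t = 0] = (1 - expR (- mu * w1) * alpha)%:E /\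
  forall (n : nat) (x : R), (1 <= n)%N -> 0 <= x ->
    P [set t | W n.+1 t <= x] =
    (1 - expR (- mu * x) *
       (2 * alpha / (2 + alpha)
        + (- alpha / 2) ^+ (n - 1)
          * ((2 - alpha) / (2 + alpha) - fine (P [set t | W 2%N t = 0]))))%:E.
Proof.
move=> mu0 w10 A0 idA expB indAB W1 WS alpha.
have mexp : measurable_fun setT (fun z : R => (expR (- mu * z))%:E).
  by apply/measurable_EFinP; apply: measurableT_comp => //; exact: measurable_funM.
have alphaE m : (\int[P]_t (expR (- mu * A m.+1 t))%:E = alpha%:E)%E.
  transitivity (\int[P]_t (expR (- mu * A 1%N t))%:E)%E.
    transitivity (\int[distribution P (A m.+1)]_z (expR (- mu * z))%:E)%E.
      by rewrite ge0_integral_distribution.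
    rewrite (@eq_measure_integral _ _ _ _ (distribution P (A 1%N))).
      by rewrite ge0_integral_distribution.
    by move=> V mV _; exact: idA.
  (* [LST] is defined through [fine], so the integral must be shown finite: its integrand is at most
     1 because [mu] and [A m.+1] are nonnegative. *)
  rewrite /alpha /LST fineK// ge0_fin_numE ?integral_ge0//.
  apply: (@le_lt_trans _ _ (\int[P]_t (cst 1%E t))%E).
    apply: ge0_le_integral => //.
    - exact: (measurableT_comp mexp).
    - by move=> t _; rewrite lee_fin -expR0 ler_expR mulNr oppr_le0 mulr_ge0// ?A0// ltW.
  by rewrite integral_cst// mul1e [ltLHS]probability_setT ltry.
have alpha0 : 0 <= alpha.
  by rewrite -lee_fin -(alphaE 0%N) integral_ge0.
have W0 m t : 0 <= W m.+1 t by exact: W_ge0 W1 WS _ _ w10.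
pose WRV m : {RV P >-> R} := HB.pack (W m.+1)
  (isMeasurableFun.Build _ _ _ _ _ (measurable_W A B w1 W W1 WS m)).
(* [w m] is the candidate transform of [W m.+1], hence shifted by one. *)
pose w m := iteri m (fun _ u => 1 - alpha * u / 2) (expR (- mu * w1)).
(* The value of the transform is a premise so that this tail can drive the induction step proving
   that very value in [lstW]. *)
have tail m x : (\int[P]_t (expR (- mu * W m.+1 t))%:E = (w m)%:E)%E -> 0 <= x ->
    P [set t | x < W m.+2 t] = (alpha * w m * expR (- mu * x))%:E.
  move=> lstW x0.
  have mAW : measurable_fun setT (fun t => A m.+1 t + WRV m t).
    exact: measurable_funD.
  pose AW : {RV P >-> R} := HB.pack (fun t => A m.+1 t + WRV m t)
    (isMeasurableFun.Build _ _ _ _ _ mAW).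
  have -> : [set t | x < W m.+2 t] = [set t | x < B m.+2 t - AW t].
    apply/funext => t; apply/propext; rewrite /= WS// lt_max ltNge x0/=.
    by rewrite opprD addrA.
  rewrite (@exponential_exceeds _ _ _ _ mu)//.
  - rewrite (laplace_add mu (A m.+1) (WRV m)).
      by rewrite alphaE lstW -!EFinM mulrC.
    move=> U V mU mV; rewrite setIC muleC.
    exact: (independent_W_A A B w1 W W1 WS indAB).
  - exact: (independent_AW_B A B w1 W W1 WS indAB).
  - by move=> t; apply: (addr_ge0 (A0 _ _ _) (W0 _ _)).
  - by move=> V mV; exact: expB.
have lst_ge0 m : (\int[P]_t (expR (- mu * W m.+1 t))%:E = (w m)%:E)%E -> 0 <= w m.
  by move=> lstW; rewrite -lee_fin -lstW integral_ge0.
have lstW m : (\int[P]_t (expR (- mu * W m.+1 t))%:E = (w m)%:E)%E.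
  elim: m => [|m IHm].
    under eq_integral do rewrite W1.
    by rewrite integral_cst// [X in (_ * X)%E]probability_setT mule1.
  (* Nonnegativity of [W] allows the clamped integrand; the law of [B 1] then acts as the reference
     exponential law. *)
  transitivity (\int[distribution P (WRV m.+1)]_z (expR (- mu * maxr 0 z))%:E)%E.
    rewrite ge0_integral_distribution//; last first.
      by apply/measurable_EFinP; exact: measurable_expR_max.
    by apply: eq_integral => t _ /=; rewrite (max_idPr (W0 _ _)).
  apply: (@laplace_of_exponential_tailE _ mu (distribution P (B 1%N))).
  - by move=> V mV; exact: expB.
  - by rewrite mulr_ge0// lst_ge0.
  - by move=> x x0; exact: tail.
have mainE m x : 0 <= x ->
    P [set t | W m.+2 t <= x] = (1 - expR (- mu * x) * (alpha * w m))%:E.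
  move=> x0; rewrite (_ : [set t | _] = ~` [set t | x < W m.+2 t]).
    rewrite probability_setC; first by rewrite tail// mulrC.
    apply: measurable_lt_set => //; exact: (measurable_W A B w1 W W1 WS).
  by apply/funext => t; apply/propext; rewrite /= leNgt; split => /negP.
(* As [W] is nonnegative, this is the distribution function at 0. *)
have P2 : P [set t | W 2%N t = 0] = (1 - expR (- mu * w1) * alpha)%:E.
  rewrite (_ : [set t | _] = [set t | W 2%N t <= 0]).
    by rewrite mainE// mulr0 expR0 mul1r [alpha * _]mulrC.
  apply/funext => t; apply/propext; split => /= [->//|Wt].
  by apply/eqP; rewrite eq_le Wt W0.
split => // -[//|m] x _ x0.
rewrite mainE// P2/= subn1/=; congr (1 - _ * _)%:E.
have a2 : 2 + alpha != 0 by rewrite gt_eqF// ltr_wpDr.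
(* The affine map has fixed point [2 / (2 + alpha)] and slope [- alpha / 2], whence the constant
   term and the geometric factor of [alpha * w m]. *)
elim: m => [|m IHm]; first by rewrite expr0 /w/=; field.
rewrite [w _]/= -/(w m) IHm exprS; field.
exact: a2.
Qed.
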